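(* Let $\alpha\in[1,\infty]$, $Q\in[1,\infty)$, let $f=h+\overline g\in\mathcal H(\alpha,Q)$, and write $h(z)=h'(0)H(z)$. Then $$\frac{d_H(z)}{Q}\le d_f(z)\le Q\,d_H(z)\quad\text{for all }z\in\mathbb D .$$
   Context: $\mathbb D=\{z\in\mathbb C:|z|<1\}$; $\mathrm{Aut}(\mathbb D)$ is the set of maps $\phi(z)=e^{i\theta}\frac{z+a}{1+\overline a z}$, $|a|<1$, $\theta\in\mathbb R$. Radius of the largest univalent disk: for a locally univalent smooth map $f:\mathbb D\to\mathbb C$ (viewed as a univalent map onto a manifold, i.e. a Riemann surface, spread over $\mathbb C$) and $z\in\mathbb D$, $d_f(z)$ is the radius of the largest univalent disk on $f(\mathbb D)$ centered at $f(z)$, that is, the supremum of $r>0$ such that some open subset of $\mathbb D$ containing $z$ is mapped by $f$ univalently onto the disk $\{w:|w-f(z)|<r\}$. The same definition is used for analytic functions. Linear invariant families (analytic case): a non-empty collection $\mathfrak M$ of analytic functions $h$ in $\mathbb D$ with $h'\ne0$ in $\mathbb D$, normalized by $h(z)=z+\sum_{n\ge2}a_n(h)z^n$, is a linear invariant family (LIF) if for each $h\in\mathfrak M$ and $\phi\in\mathrm{Aut}(\mathbb D)$ the function $\frac{h(\phi(z))-h(\phi(0))}{h'(\phi(0))\phi'(0)}$ belongs to $\mathfrak M$. Its order is $\sup_{h\in\mathfrak M}|a_2(h)|$. $\mathcal U_\alpha$ is the union of all LIFs of order at most $\alpha$ (non-empty iff $\alpha\ge1$); $\mathcal U_\infty$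 consists of all analytic locally univalent functions in $\mathbb D$ with this normalization. The class $\mathcal H(\alpha,Q)$: the set of all locally univalent sense-preserving harmonic mappings $f=h+\overline g$ in $\mathbb D$, with $h,g$ analytic, $f(z)=\sum_{n\ge1}(a_nz^n+a_{-n}\overline z^{\,n})$ (so $h(0)=g(0)=0$, $a_1=h'(0)$, $a_{-1}=\overline{g'(0)}$), normalized by $a_1+a_{-1}=1$, such that $h(z)/h'(0)\in\mathcal U_\alpha$ and $|g'(z)/h'(z)|\le k$ in $\mathbb D$, with $k=(Q-1)/(Q+1)$. Sense-preserving and locally univalent means $|h'|^2-|g'|^2>0$ in $\mathbb D$. *)

(* Defs.v *)
From Stdlib Require Export Reals.
From Coquelicot Require Export Coquelicot.
Open Scope R_scope.

(* Functions on the unit disk are represented by total functions [C -> C] of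
   which only the values on the disk matter. *)
Definition unit_disk (z : C) : Prop := Cmod z < 1.

Definition eq_on_disk (f g : C -> C) : Prop :=
  forall z, unit_disk z -> f z = g z.

(* Every point of the disk is the centre of a convergent power series
   representing the function near that point. *)
Definition analytic (f : C -> C) : Prop :=
  forall z0, unit_disk z0 ->
    exists (a : nat -> C) (r : R), 0 < r /\
      forall z, Cmod (z - z0) < r ->
        @is_pseries C_AbsRing C_NormedModule a (z - z0)%C (f z).

Definition locally_univalent (f : C -> C) : Prop :=
  forall z0, unit_disk z0 ->
    exists r : R, 0 < r /\
      forall z w, unit_disk z -> unit_disk w ->
        Cmod (z - z0) < r -> Cmod (w - z0) < r -> f z = f w -> z = w.

(* [f] maps an open subset of the unit disk containing [z] univalently onto the
   disk of radius [r] centred at [f z]. *)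
Definition univalent_disk (f : C -> C) (z : C) (r : R) : Prop :=
  exists U : C -> Prop,
    @open C_UniformSpace U /\ U z /\
    (forall x, U x -> unit_disk x) /\
    (forall x y, U x -> U y -> f x = f y -> x = y) /\
    (forall w, Cmod (w - f z) < r <-> exists x, U x /\ f x = w).

(* Radius of the largest univalent disk, possibly [+oo]. *)
Definition univalent_radius (f : C -> C) (z : C) : Rbar :=
  Lub_Rbar (fun r => 0 < r /\ univalent_disk f z r).

Definition disk_automorphism (phi : C -> C) : Prop :=
  exists (theta : R) (a : C), Cmod a < 1 /\
    eq_on_disk phi
      (fun z => (cos theta, sin theta) * ((z + a) / (1 + Cconj a * z)))%C.

Definition maclaurin (h : C -> C) (a : nat -> C) : Prop :=
  forall z, unit_disk z -> @is_pseries C_AbsRing C_NormedModule a z (h z).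

(* h(z) = z + sum_(n >= 2) a_n z^n *)
Definition normalized (h : C -> C) : Prop :=
  exists a, maclaurin h a /\ a 0%nat = 0 /\ a 1%nat = 1.

Definition family_mem (M : (C -> C) -> Prop) (h : C -> C) : Prop :=
  exists h0, M h0 /\ eq_on_disk h0 h.

Definition linear_invariant_family (M : (C -> C) -> Prop) : Prop :=
  (exists h, M h) /\
  (forall h, M h ->
     analytic h /\ (forall z, unit_disk z -> C_derive h z <> 0) /\
     normalized h) /\
  (forall h phi, M h -> disk_automorphism phi ->
     family_mem M (fun z =>
       (h (phi z) - h (phi 0)) / (C_derive h (phi 0) * C_derive phi 0))%C).

(* sup |a_2(h)| over the family *)
Definition family_order (M : (C -> C) -> Prop) : Rbar :=
  Lub_Rbar (fun x =>
    exists h a, M h /\ maclaurin h a /\ x = Cmod (a 2%nat)).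

(* The universal family U_alpha; U_oo is not defined through families. *)
Definition universal_LIF (alpha : Rbar) (h : C -> C) : Prop :=
  match alpha with
  | p_infty => analytic h /\ locally_univalent h /\ normalized h
  | _ => exists M, linear_invariant_family M /\
           Rbar_le (family_order M) alpha /\ family_mem M h
  end.

(* f = h + conj g on the disk, with h(0) = g(0) = 0; this determines h and g. *)
Definition harmonic_decomposition (f h g : C -> C) : Prop :=
  analytic h /\ analytic g /\ h 0 = 0 /\ g 0 = 0 /\
  eq_on_disk f (fun z => h z + Cconj (g z))%C.

(* The class H(alpha, Q). A positive Jacobian |h'|^2 - |g'|^2 means that f is
   locally univalent and sense-preserving. *)
Definition harmonic_class (alpha : Rbar) (Q : R) (f : C -> C) : Prop :=
  exists h g : C -> C,
    harmonic_decomposition f h g /\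
    (forall z, unit_disk z ->
       0 < Cmod (C_derive h z) ^ 2 - Cmod (C_derive g z) ^ 2) /\
    (C_derive h 0 + Cconj (C_derive g 0))%C = 1 /\
    universal_LIF alpha (fun z => h z / C_derive h 0)%C /\
    (forall z, unit_disk z ->
       Cmod (C_derive g z / C_derive h z) <= (Q - 1) / (Q + 1)).

(* Main.v *)
Require Import Defs.
From Stdlib Require Import Lra Lia Psatz ClassicalEpsilon.

(* Let [k = (Q - 1) / (Q + 1)].  Where [h] is univalent onto a disk, the map
   [f o h^-1 = id + conj (g o h^-1)] is the identity plus a [k]-Lipschitz map.
   Where [f] is univalent onto a disk, the map [h o f^-1] is
   [1 / (1 - k^2)] times the identity plus a [k / (1 - k^2)]-Lipschitz map,
   since [|Y| <= k |X|] implies [|k^2 X + conj Y| <= k |X + conj Y|].  Banach's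
   fixed point theorem then yields [d_f >= (1 - k) d_h] and
   [d_h >= d_f / (1 + k)], and [h'(0) + conj (g'(0)) = 1] bounds [|h'(0)|]
   between [1 / (1 + k)] and [1 / (1 - k)]. *)

(** Everything is phrased with differences at pairs of points, through [near_scaling]. Thus neither
    the inverse branches nor the non-holomorphic [f] is ever differentiated, and one covering lemma
    serves both directions. The constants [1 / (1 - k^2)] and [k / (1 - k^2)] are those of an
    Apollonius disk: with [W = X + conj Y], the condition [|W - X| <= k |X|] confines [X] to the
    disk of centre [W / (1 - k^2)] and radius [k |W| / (1 - k^2)]. The obstacle is that
    [|g'| <= k |h'|], read off the derivatives at one point, compares nearby differences of [g] and
    [h] only up to a factor [l > k]. Disks are therefore transported with a loss [Q' > Q], and [Q']
    tends to [Q] in the supremum. Since [Q = (1 + k) / (1 - k)], both halves end with the factor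
    [1 / Q]: one combines [1 - k] with [|h'(0)| >= 1 / (1 + k)], the other [1 / (1 + k)] with
    [1 / |h'(0)| >= 1 - k]. *)

Definition disc (c : C) (r : R) (z : C) : Prop := Cmod (z - c) < r.

(** * Distance and convergence in [C] through [Cmod] *)

Lemma Cmod_sub_sym (x y : C) : Cmod (x - y) = Cmod (y - x).
Proof. rewrite <- Cmod_opp; f_equal; ring. Qed.

Lemma Cmod_sub_triangle (x y z : C) :
  Cmod (x - z) <= Cmod (x - y) + Cmod (y - z).
Proof.
  replace (x - z)%C with ((x - y) + (y - z))%C by ring; apply Cmod_triangle.
Qed.

Lemma Cmod_le_add (x y : C) : Cmod x <= Cmod y + Cmod (x - y).
Proof.
  replace x with (y + (x - y))%C at 1 by ring; apply Cmod_triangle.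
Qed.

Lemma Cmod_add_le (x y : C) : Cmod x <= Cmod (x + y) + Cmod y.
Proof.
  replace x with ((x + y) + - y)%C at 1 by ring.
  rewrite <- (Cmod_opp y); apply Cmod_triangle.
Qed.

Lemma Cmod_sub_self (x : C) : Cmod (x - x) = 0.
Proof. replace (x - x)%C with (RtoC 0) by ring; apply Cmod_0. Qed.

Lemma Cmod_sub_eq_0 (x y : C) : Cmod (x - y) <= 0 -> x = y.
Proof.
  intros Hle.
  assert (H0 : (x - y)%C = 0)
    by (apply Cmod_eq_0; pose proof (Cmod_ge_0 (x - y)%C); lra).
  replace x with ((x - y) + y)%C by ring; rewrite H0; ring.
Qed.

(** Balls of the uniform structure on [C] are coordinatewise, hence squares. The factor [sqrt 2]
    fits such a square into a round disc. *)
Lemma filterlim_C_Cmod (u : nat -> C) (l : C) :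
  filterlim u eventually (@locally C_UniformSpace l) ->
  forall eps, 0 < eps -> exists N, forall n, (N <= n)%nat -> Cmod (u n - l) < eps.
Proof.
  intros Hlim eps Heps.
  assert (H2 : 0 < sqrt 2) by (apply sqrt_lt_R0; lra).
  assert (He : 0 < eps / sqrt 2) by (apply Rdiv_lt_0_compat; lra).
  destruct (proj1 (filterlim_locally u l) Hlim (mkposreal _ He)) as [N HN].
  exists N; intros n Hn.
  pose proof (C_NormedModule_mixin_compat2 l (u n) (mkposreal _ He) (HN n Hn)) as Hb.
  simpl in Hb.
  replace (sqrt 2 * (eps / sqrt 2)) with eps in Hb by (field; lra).
  exact Hb.
Qed.

Lemma Cmod_lim_le (u : nat -> C) (l c : C) (B : R) (N0 : nat) :
  (forall eps, 0 < eps -> exists N, forall n, (N <= n)%nat -> Cmod (u n - l) < eps) ->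
  (forall n, (N0 <= n)%nat -> Cmod (u n - c) <= B) -> Cmod (l - c) <= B.
Proof.
  intros Hlim HB; apply le_epsilon; intros eps Heps.
  destruct (Hlim eps Heps) as [N HN].
  specialize (HN (max N N0) (Nat.le_max_l _ _)).
  specialize (HB (max N N0) (Nat.le_max_r _ _)).
  pose proof (Cmod_sub_triangle l (u (max N N0)) c) as Ht.
  rewrite (Cmod_sub_sym l (u _)) in Ht; lra.
Qed.

Lemma locally_C_iff (x : C) (P : C -> Prop) :
  @locally C_UniformSpace x P <-> exists d, 0 < d /\ forall y, disc x d y -> P y.
Proof.
  split.
  - intros [d Hd]; exists d; split; [apply cond_pos|]; intros y Hy.
    apply Hd, (C_NormedModule_mixin_compat1 x y d), Hy.
  - intros [d [Hd HdP]].
    assert (H2 : 0 < sqrt 2) by (apply sqrt_lt_R0; lra).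
    assert (He : 0 < d / sqrt 2) by (apply Rdiv_lt_0_compat; lra).
    exists (mkposreal _ He); intros y Hy; apply HdP.
    pose proof (C_NormedModule_mixin_compat2 x y (mkposreal _ He) Hy) as Hb.
    simpl in Hb.
    replace (sqrt 2 * (d / sqrt 2)) with d in Hb by (field; lra).
    exact Hb.
Qed.

Lemma geometric_increments_converge (v : nat -> C) (q d : R) :
  0 <= q < 1 ->
  (forall n, Cmod (v (S n) - v n) <= d * q ^ n) ->
  exists l, forall eps, 0 < eps ->
    exists N, forall n, (N <= n)%nat -> Cmod (v n - l) < eps.
Proof.
  intros Hq Hv.
  assert (Hs : @ex_series C_AbsRing C_CompleteNormedModule
                 (fun n => (v (S n) - v n)%C)).
  { apply (ex_series_le _ (fun n => d * q ^ n)).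
    - exact Hv.
    - apply (ex_series_scal_l (K := R_AbsRing) d (fun n => q ^ n)).
      apply ex_series_geom; rewrite Rabs_pos_eq; lra. }
  destruct Hs as [s Hs].
  (* The partial sum up to index [n] telescopes to [v (S n) - v 0], hence the shift by [v 0] here
     and the rank [S N] below. *)
  exists (s + v 0%nat)%C; intros eps Heps.
  destruct (filterlim_C_Cmod _ _ Hs eps Heps) as [N HN].
  assert (Hsum : forall n,
    @sum_n C_AbelianMonoid (fun n => (v (S n) - v n)%C) n = (v (S n) - v 0%nat)%C).
  { induction n as [|n IH].
    - apply sum_O.
    - rewrite sum_Sn, IH; unfold plus; simpl; ring. }
  exists (S N); intros n Hn.
  destruct n as [|n]; [lia|].
  specialize (HN n ltac:(lia)).
  change (Cmod (@sum_n C_AbelianMonoid (fun n => (v (S n) - v n)%C) n - s) < eps) in HN.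
  rewrite Hsum in HN.
  replace (v (S n) - (s + v 0%nat))%C with (v (S n) - v 0%nat - s)%C by ring.
  exact HN.
Qed.

(** * Lipschitz perturbations of a scaling *)

Definition near_scaling (G : C -> C) (lam : C) (kap : R) (D : C -> Prop) : Prop :=
  forall v w, D v -> D w ->
    Cmod (G v - G w - lam * (v - w)) <= kap * Cmod (v - w).

Lemma near_scaling_expands (G : C -> C) (lam : C) (kap : R) (D : C -> Prop) (v w : C) :
  near_scaling G lam kap D -> D v -> D w ->
  (Cmod lam - kap) * Cmod (v - w) <= Cmod (G v - G w).
Proof.
  intros HG Hv Hw; specialize (HG v w Hv Hw).
  pose proof (Cmod_le_add (lam * (v - w)) (G v - G w)) as Ht.
  rewrite (Cmod_sub_sym (lam * _)), Cmod_mult in Ht; lra.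
Qed.

Lemma near_scaling_lipschitz (G : C -> C) (lam : C) (kap : R) (D : C -> Prop) (v w : C) :
  near_scaling G lam kap D -> D v -> D w ->
  Cmod (G v - G w) <= (Cmod lam + kap) * Cmod (v - w).
Proof.
  intros HG Hv Hw; specialize (HG v w Hv Hw).
  pose proof (Cmod_le_add (G v - G w) (lam * (v - w))) as Ht.
  rewrite Cmod_mult in Ht; lra.
Qed.

(* Banach's fixed point theorem for [v |-> v + (p - G v) / lam]. *)
Lemma near_scaling_covers (G : C -> C) (lam c p : C) (kap r : R) :
  0 <= kap < Cmod lam ->
  near_scaling G lam kap (disc c r) ->
  Cmod (p - G c) < (Cmod lam - kap) * r ->
  exists v, disc c r v /\ G v = p.
Proof.
  intros [Hk Hlam] HG Hp.
  assert (Hl0 : lam <> 0) by (apply Cmod_gt_0; lra).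
  assert (Hr : 0 < r) by (pose proof (Cmod_ge_0 (p - G c)); nra).
  set (L := Cmod lam) in *.
  set (T := fun v => (v + (p - G v) / lam)%C).
  set (q := kap / L); set (d := Cmod (p - G c) / L).
  assert (HqL : q * L = kap) by (unfold q; field; lra).
  assert (HdL : d * L = Cmod (p - G c)) by (unfold d; field; lra).
  assert (Hq : 0 <= q < 1) by (split; nra).
  assert (Hd : 0 <= d) by (pose proof (Cmod_ge_0 (p - G c)); nra).
  assert (Hdr : d < (1 - q) * r) by nra.
  assert (HT : forall v w, disc c r v -> disc c r w ->
            Cmod (T v - T w) <= q * Cmod (v - w)).
  { intros v w Hv Hw; specialize (HG v w Hv Hw).
    assert (Heq : (T v - T w)%C = (- (G v - G w - lam * (v - w)) / lam)%C)
      by (unfold T; field; exact Hl0).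
    rewrite Heq, Cmod_div, Cmod_opp by exact Hl0; fold L.
    apply Rmult_le_reg_r with L; [lra|].
    replace (_ / L * L) with (Cmod (G v - G w - lam * (v - w))) by (field; lra).
    replace (q * _ * L) with (q * L * Cmod (v - w)) by ring.
    rewrite HqL; exact HG. }
  set (v := fun n => Nat.iter n T c).
  (* [T] is known to contract only inside the disc, so the induction also keeps the iterates there.
     The first bound is the geometric sum of the increments, multiplied by [1 - q]. *)
  assert (Hv : forall n, (1 - q) * Cmod (v n - c) <= d * (1 - q ^ n) /\
                  Cmod (v (S n) - v n) <= d * q ^ n).
  { induction n as [|n [IH1 IH2]].
    - simpl; rewrite Cmod_sub_self; split; [lra|].
      replace (T c - c)%C with ((p - G c) / lam)%C by (unfold T; ring).
      rewrite Cmod_div by exact Hl0; fold L d; lra.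
    - assert (IH3 : (1 - q) * Cmod (v (S n) - c) <= d * (1 - q ^ S n)).
      { pose proof (Cmod_sub_triangle (v (S n)) (v n) c); simpl pow; nra. }
      split; [exact IH3|].
      assert (Hin : forall m, (1 - q) * Cmod (v m - c) <= d * (1 - q ^ m) ->
                       disc c r (v m)).
      { intros m Hm; pose proof (pow_le q m (proj1 Hq)); unfold disc; nra. }
      change (Cmod (T (v (S n)) - T (v n)) <= d * q ^ S n).
      pose proof (HT _ _ (Hin _ IH3) (Hin _ IH1)); simpl pow; nra. }
  assert (Hin : forall n, Cmod (v n - c) <= d / (1 - q)).
  { intros n; destruct (Hv n) as [Hn _]; pose proof (pow_le q n (proj1 Hq)).
    apply Rmult_le_reg_l with (1 - q); [lra|].
    replace ((1 - q) * (d / (1 - q))) with d by (field; lra); nra. }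
  (* Strictness keeps the limit, and not only the iterates, in the open disc. *)
  assert (Hdq : d / (1 - q) < r).
  { apply Rmult_lt_reg_l with (1 - q); [lra|].
    replace ((1 - q) * (d / (1 - q))) with d by (field; lra); lra. }
  destruct (geometric_increments_converge v q d Hq (fun n => proj2 (Hv n))) as [l Hl].
  assert (Hlc : disc c r l).
  { apply Rle_lt_trans with (d / (1 - q)); [|exact Hdq].
    apply (Cmod_lim_le v l c _ 0 Hl); intros; apply Hin. }
  exists l; split; [exact Hlc|].
  assert (HTl : T l = l).
  { apply Cmod_sub_eq_0, le_epsilon; intros eps Heps.
    destruct (Hl (eps / 2) ltac:(lra)) as [N HN].
    pose proof (Cmod_sub_triangle (T l) (v (S N)) l) as Ht.
    assert (Hvn : disc c r (v N)) by (apply Rle_lt_trans with (2 := Hdq), Hin).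
    pose proof (HT l (v N) Hlc Hvn) as HTN.
    rewrite (Cmod_sub_sym l) in HTN.
    pose proof (HN N (le_n _)); pose proof (HN (S N) ltac:(lia)).
    pose proof (Cmod_ge_0 (v N - l)%C).
    change (Cmod (T l - v (S N)) <= q * Cmod (v N - l)) in HTN; nra. }
  unfold T in HTl.
  replace (G l) with (p - ((l + (p - G l) / lam) - l) * lam)%C by (field; exact Hl0).
  rewrite HTl; ring.
Qed.

(** * Mean value inequality on discs *)

(** Continuous induction. Let [T] be the supremum of the times up to which the bound from [0] holds.
    The local estimate at [T], applied to an earlier time in [A], puts [T] in [A]; applied to a
    later time it exceeds [T], unless [T = 1]. *)
Lemma path_lipschitz (P : R -> C) (M : R) :
  (forall t, 0 <= t <= 1 -> exists d, 0 < d /\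
     forall s, 0 <= s <= 1 -> Rabs (s - t) < d ->
       Cmod (P s - P t) <= M * Rabs (s - t)) ->
  Cmod (P 1 - P 0) <= M.
Proof.
  intros HP.
  set (A := fun t => 0 <= t <= 1 /\ Cmod (P t - P 0) <= M * t).
  assert (HA0 : A 0) by (split; [lra|]; rewrite Cmod_sub_self; lra).
  destruct (completeness A) as [T [Tub Tlub]].
  - exists 1; intros t [Ht _]; lra.
  - exists 0; exact HA0.
  - assert (HT : 0 <= T <= 1).
    { split; [apply Tub, HA0|]; apply Tlub; intros t [Ht _]; lra. }
    destruct (HP T HT) as [d [Hd HdP]].
    assert (Hs : exists s, A s /\ T - d < s).
    { apply NNPP; intros Hn.
      assert (T <= T - d); [|lra].
      apply Tlub; intros s As; apply Rnot_lt_le; intros Hlt.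
      apply Hn; exists s; tauto. }
    destruct Hs as [s [As Hs]].
    assert (HsT : s <= T) by (apply Tub, As).
    destruct As as [Hs1 As].
    assert (AT : Cmod (P T - P 0) <= M * T).
    { pose proof (HdP s Hs1) as Hst.
      rewrite Rabs_minus_sym, Rabs_pos_eq in Hst by lra.
      pose proof (Cmod_sub_triangle (P T) (P s) (P 0)) as Ht.
      rewrite (Cmod_sub_sym (P T) (P s)) in Ht; specialize (Hst ltac:(lra)); nra. }
    destruct (Req_dec T 1) as [->|HT1]; [lra|].
    set (e := Rmin (d / 2) (1 - T)).
    assert (He : 0 < e /\ e < d /\ e <= 1 - T).
    { unfold e; pose proof (Rmin_l (d / 2) (1 - T)); pose proof (Rmin_r (d / 2) (1 - T)).
      split; [apply Rmin_pos|]; lra. }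
    assert (A (T + e)); [|pose proof (Tub (T + e) ltac:(assumption)); lra].
    split; [lra|].
    pose proof (HdP (T + e) ltac:(lra)) as Hst.
    replace (T + e - T) with e in Hst by ring.
    rewrite Rabs_pos_eq in Hst by lra.
    pose proof (Cmod_sub_triangle (P (T + e)) (P T) (P 0)).
    specialize (Hst ltac:(lra)); nra.
Qed.

Lemma disc_segment (c v w : C) (r t : R) :
  disc c r v -> disc c r w -> 0 <= t <= 1 -> disc c r (v + t * (w - v))%C.
Proof.
  unfold disc; intros Hv Hw Ht.
  replace (v + t * (w - v) - c)%C
    with (RtoC (1 - t) * (v - c) + RtoC t * (w - c))%C
    by (rewrite RtoC_minus; ring).
  eapply Rle_lt_trans; [apply Cmod_triangle|].
  rewrite !Cmod_mult, !Cmod_R, !Rabs_pos_eq by lra.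
  destruct (Req_dec t 0) as [->|]; [lra|]; nra.
Qed.

Lemma disc_lipschitz (E : C -> C) (c : C) (r M : R) :
  (forall v, disc c r v -> exists d, 0 < d /\
     forall w, disc c r w -> disc v d w -> Cmod (E w - E v) <= M * Cmod (w - v)) ->
  forall v w, disc c r v -> disc c r w -> Cmod (E w - E v) <= M * Cmod (w - v).
Proof.
  intros HE v w Hv Hw.
  assert (Hp : forall s t : R,
    Cmod ((v + s * (w - v)) - (v + t * (w - v))) = Rabs (s - t) * Cmod (w - v)).
  { intros s t; rewrite <- Cmod_R, <- Cmod_mult, RtoC_minus; f_equal; ring. }
  set (P := fun t : R => E (v + t * (w - v))%C).
  replace (E w) with (P 1) by (unfold P; f_equal; ring).
  replace (E v) with (P 0) by (unfold P; f_equal; ring).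
  apply path_lipschitz; intros t Ht.
  destruct (HE _ (disc_segment c v w r t Hv Hw Ht)) as [d [Hd HdE]].
  pose proof (Cmod_ge_0 (w - v)%C).
  (* The [+ 1] keeps the denominator positive when [v = w]. *)
  assert (He : 0 < d / (Cmod (w - v) + 1)) by (apply Rdiv_lt_0_compat; lra).
  exists (d / (Cmod (w - v) + 1)); split; [exact He|].
  intros s Hs Hst; unfold P.
  eapply Rle_trans.
  - apply HdE; [apply disc_segment; assumption|].
    unfold disc; rewrite Hp.
    replace d with (d / (Cmod (w - v) + 1) * (Cmod (w - v) + 1)) by (field; lra).
    pose proof (Rabs_pos (s - t)); nra.
  - rewrite Hp; lra.
Qed.

(** * Strict derivatives of analytic functions *)

(** Both points move, unlike in [C_derive]: the estimate must hold for all pairs near [z], in order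
    to bound differences from below and to compare those of [g] and [h]. *)
Definition strict_derivative (f : C -> C) (z l : C) : Prop :=
  forall eps, 0 < eps -> exists d, 0 < d /\ near_scaling f l eps (disc z d).

Lemma disc_center (c : C) (r : R) : 0 < r -> disc c r c.
Proof. intros Hr; unfold disc; rewrite Cmod_sub_self; exact Hr. Qed.

Lemma strict_derivative_C_derive (f : C -> C) (z l : C) :
  strict_derivative f z l -> C_derive f z = l.
Proof.
  intros Hf; apply is_C_lim_unique, filterlim_locally; intros eps.
  destruct (Hf (eps / 2)) as [d [Hd Hdf]]; [pose proof (cond_pos eps); lra|].
  apply locally_C_iff; exists d; split; [exact Hd|].
  intros y Hy Hyz.
  assert (Hyz' : (y - z)%C <> 0).
  { intros H0; apply Hyz, Cmod_sub_eq_0; rewrite H0, Cmod_0; lra. }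
  apply C_NormedModule_mixin_compat1.
  change (Cmod ((f y - f z) / (y - z) - l) < eps).
  replace ((f y - f z) / (y - z) - l)%C
    with ((f y - f z - l * (y - z)) / (y - z))%C by (field; exact Hyz').
  rewrite Cmod_div by exact Hyz'.
  specialize (Hdf y z Hy (disc_center z d Hd)).
  apply Cmod_gt_0 in Hyz'; pose proof (cond_pos eps).
  apply Rmult_lt_reg_r with (Cmod (y - z)); [exact Hyz'|].
  replace (_ / _ * _) with (Cmod (f y - f z - l * (y - z))) by (field; lra); nra.
Qed.

Lemma pow_n_diff_le (z w : C) (rho : R) (n : nat) :
  Cmod z <= rho -> Cmod w <= rho ->
  Cmod (pow_n (K := C_Ring) z (S n) - pow_n (K := C_Ring) w (S n))
    <= INR (S n) * rho ^ n * Cmod (z - w).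
Proof.
  intros Hz Hw.
  assert (Hrho : 0 <= rho) by (pose proof (Cmod_ge_0 z); lra).
  assert (Hpow : forall n, Cmod (pow_n (K := C_Ring) w n) <= rho ^ n).
  { clear n; induction n as [|n IH]; simpl.
    - change (Cmod 1 <= 1); rewrite Cmod_1; lra.
    - change (Cmod (w * pow_n (K := C_Ring) w n) <= rho * rho ^ n).
      rewrite Cmod_mult; apply Rmult_le_compat; auto using Cmod_ge_0. }
  induction n as [|n IH].
  - simpl; change (Cmod (z * 1 - w * 1) <= 1 * 1 * Cmod (z - w)).
    rewrite !Cmult_1_r; lra.
  - change (pow_n (K := C_Ring) z (S (S n))) with (z * pow_n (K := C_Ring) z (S n))%C.
    change (pow_n (K := C_Ring) w (S (S n))) with (w * pow_n (K := C_Ring) w (S n))%C.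
    set (x := pow_n (K := C_Ring) z (S n)) in *.
    set (y := pow_n (K := C_Ring) w (S n)) in *.
    replace (z * x - w * y)%C with (z * (x - y) + y * (z - w))%C by ring.
    eapply Rle_trans; [apply Cmod_triangle|]; rewrite !Cmod_mult.
    assert (H1 : Cmod z * Cmod (x - y) <= rho * (INR (S n) * rho ^ n * Cmod (z - w)))
      by (apply Rmult_le_compat; auto using Cmod_ge_0).
    assert (H2 : Cmod y * Cmod (z - w) <= rho ^ S n * Cmod (z - w))
      by (apply Rmult_le_compat_r; [apply Cmod_ge_0|apply Hpow]).
    rewrite (S_INR (S n)); simpl pow in *; nra.
Qed.

(** Each term after the first is the difference of two consecutive partial sums, which are bounded
    by convergence; hence the bound [2 * M]. *)
Lemma pseries_terms_bounded (a : nat -> C) (x l : C) :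
  @is_pseries C_AbsRing C_NormedModule a x l ->
  exists M, forall n, Cmod (a n) * Cmod x ^ n <= M.
Proof.
  intros Hs.
  destruct (filterlim_bounded _ (ex_intro _ l Hs)) as [M HM].
  assert (Hpow : forall n, Cmod (pow_n (K := C_Ring) x n) = Cmod x ^ n).
  { induction n as [|n IH].
    - exact Cmod_1.
    - change (Cmod (x * pow_n (K := C_Ring) x n) = Cmod x * Cmod x ^ n).
      rewrite Cmod_mult, IH; reflexivity. }
  set (t := fun n => (pow_n (K := C_Ring) x n * a n)%C).
  assert (HM' : forall n, Cmod (@sum_n C_AbelianMonoid t n) <= M)
    by exact HM.
  exists (2 * M); intros n.
  rewrite <- Hpow, Rmult_comm, <- Cmod_mult; fold (t n).
  destruct n as [|n].
  - pose proof (HM' 0%nat) as H0; rewrite sum_O in H0.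
    pose proof (Cmod_ge_0 (t 0%nat)); lra.
  - pose proof (HM' n); pose proof (HM' (S n)) as HS; rewrite sum_Sn in HS.
    change (Cmod (@sum_n C_AbelianMonoid t n + t (S n)) <= M) in HS.
    rewrite Cplus_comm in HS.
    pose proof (Cmod_add_le (t (S n)) (@sum_n C_AbelianMonoid t n)); lra.
Qed.

Lemma INR_le_pow (n : nat) : INR n <= 2 * (3 / 2) ^ n.
Proof.
  induction n as [|n IH]; [simpl; lra|].
  assert (1 <= (3 / 2) ^ n) by (apply pow_R1_Rle; lra).
  rewrite S_INR; simpl pow; lra.
Qed.

(** In the series of [f z - f w] the constant term cancels and the linear one is exactly
    [a 1 * (z - w)]. Every later term carries, besides [z - w], a factor [d], the radius of the
    disc, so the remainder is made small by shrinking [d]. *)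
Lemma pseries_strict_derivative (f : C -> C) (z0 : C) (a : nat -> C) (r : R) :
  0 < r ->
  (forall z, Cmod (z - z0) < r ->
     @is_pseries C_AbsRing C_NormedModule a (z - z0)%C (f z)) ->
  strict_derivative f z0 (a 1%nat).
Proof.
  intros Hr Hf eps Heps.
  assert (HM : exists M, 0 < M /\ forall n, Cmod (a n) * (r / 2) ^ n <= M).
  { destruct (pseries_terms_bounded a (r / 2)%R (f (z0 + (r / 2)%R)%C)) as [M HM].
    - replace (RtoC (r / 2)) with (z0 + (r / 2)%R - z0)%C at 1 by ring.
      apply Hf; replace (z0 + (r / 2)%R - z0)%C with (RtoC (r / 2)) by ring.
      rewrite Cmod_R, Rabs_pos_eq; lra.
    - exists (Rmax M 1); split; [pose proof (Rmax_r M 1); lra|]; intros n.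
      specialize (HM n); rewrite Cmod_R, Rabs_pos_eq in HM by lra.
      pose proof (Rmax_l M 1); lra. }
  destruct HM as [M [HM0 HM]].
  set (r1 := r / 2) in *.
  assert (Hr1 : 0 < r1) by (unfold r1; lra).
  set (K := M / r1 ^ 2).
  assert (HK : 0 < K) by (unfold K; apply Rdiv_lt_0_compat; [|apply pow_lt]; lra).
  (* The terms from degree 2 on are at most [8 * K * d * (3 / 4) ^ m * Cmod (z - w)], and the powers
     of [3 / 4] sum to 4, which gives [32 * K * d]. The square in [K] comes from lowering the
     exponent of [r1 / 2] by two. *)
  set (d := Rmin (r1 / 2) (eps / (32 * K))).
  assert (Hd : 0 < d).
  { apply Rmin_pos; [|apply Rdiv_lt_0_compat]; lra. }
  exists d; split; [exact Hd|].
  assert (Hdr : d <= r1 / 2) by apply Rmin_l.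
  assert (HdK : 32 * K * d <= eps).
  { replace eps with (32 * K * (eps / (32 * K))) by (field; lra).
    apply Rmult_le_compat_l; [lra|apply Rmin_r]. }
  intros z w Hz Hw.
  set (t := fun n => ((pow_n (K := C_Ring) (z - z0)%C n
                        - pow_n (K := C_Ring) (w - z0)%C n) * a n)%C).
  assert (Hlim : @is_series C_AbsRing C_NormedModule t (f z - f w)%C).
  { unfold disc in Hz, Hw.
    pose proof (is_series_minus _ _ _ _ (Hf z ltac:(unfold r1 in *; lra))
                                 (Hf w ltac:(unfold r1 in *; lra))) as Hm.
    eapply is_series_ext; [|exact Hm].
    intros n; unfold t.
    change (pow_n (K := C_Ring) (z - z0)%C n * a n
             - pow_n (K := C_Ring) (w - z0)%C n * a n = t n)%C.
    unfold t; ring. }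
  (* [n rho^(n-1) |a_n|] is dominated by a geometric series, because
     [rho <= r1 / 2] and [n (1/2)^n <= 2 (3/4)^n]. *)
  assert (Ht : forall n, Cmod (t (S (S n))) <= 8 * K * d * (3 / 4) ^ (S (S n)) * Cmod (z - w)).
  { intros n; unfold t; rewrite Cmod_mult.
    unfold disc in Hz, Hw.
    pose proof (pow_n_diff_le (z - z0) (w - z0) d (S n) ltac:(lra) ltac:(lra)) as Hp.
    replace (z - z0 - (w - z0))%C with (z - w)%C in Hp by ring.
    set (m := S (S n)) in *.
    apply Rle_trans with (INR m * d ^ S n * Cmod (z - w) * Cmod (a m)).
    { apply Rmult_le_compat_r; [apply Cmod_ge_0|exact Hp]. }
    assert (H1 : d ^ S n <= d * (r1 / 2) ^ n).
    { simpl pow; apply Rmult_le_compat_l; [lra|]; apply pow_incr; lra. }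
    assert (H2 : INR m * (d * (r1 / 2) ^ n) * Cmod (a m)
                  <= 8 * K * d * (3 / 4) ^ m).
    { replace (INR m * (d * (r1 / 2) ^ n) * Cmod (a m))
        with (4 * d / r1 ^ 2 * (INR m * (1 / 2) ^ m) * (Cmod (a m) * r1 ^ m)).
      - replace (8 * K * d * (3 / 4) ^ m)
          with (4 * d / r1 ^ 2 * (2 * (3 / 2) ^ m * (1 / 2) ^ m) * M).
        + assert (0 <= 4 * d / r1 ^ 2)
            by (apply Rlt_le, Rdiv_lt_0_compat; [|apply pow_lt]; lra).
          assert (0 <= (1 / 2) ^ m) by (apply pow_le; lra).
          pose proof (pos_INR m).
          apply Rmult_le_compat.
          * apply Rmult_le_pos; [|apply Rmult_le_pos]; assumption.
          * apply Rmult_le_pos; [apply Cmod_ge_0|apply pow_le; lra].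
          * apply Rmult_le_compat_l; [assumption|].
            apply Rmult_le_compat_r; [assumption|apply INR_le_pow].
          * apply HM.
        + rewrite Rmult_assoc with (r1 := 2), <- Rpow_mult_distr.
          replace (3 / 2 * (1 / 2)) with (3 / 4) by field.
          unfold K; field; lra.
      - unfold m, Rdiv; rewrite Rmult_1_l, Rpow_mult_distr; simpl pow.
        field; lra. }
    pose proof (Cmod_ge_0 (z - w)%C); pose proof (Cmod_ge_0 (a m)).
    assert (INR m * d ^ S n * Cmod (a m) <= 8 * K * d * (3 / 4) ^ m).
    { eapply Rle_trans; [|exact H2]; apply Rmult_le_compat_r; [assumption|].
      apply Rmult_le_compat_l; [apply pos_INR|assumption]. }
    replace (INR m * d ^ S n * Cmod (z - w) * Cmod (a m))
      with (INR m * d ^ S n * Cmod (a m) * Cmod (z - w)) by ring.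
    apply Rmult_le_compat_r; assumption. }
  assert (Hsum : forall n, Cmod (@sum_n C_AbelianMonoid t (S n) - a 1%nat * (z - w))
             <= 8 * K * d * (4 - 4 * (3 / 4) ^ S (S n)) * Cmod (z - w)).
  { pose proof (Cmod_ge_0 (z - w)%C).
    assert (0 <= K * d * Cmod (z - w))
      by (apply Rmult_le_pos; [apply Rmult_le_pos|]; lra).
    induction n as [|n IH].
    - rewrite sum_Sn, sum_O.
      change (Cmod ((1 - 1) * a 0%nat + ((z - z0) * 1 - (w - z0) * 1) * a 1%nat - a 1%nat * (z - w))
        <= 8 * K * d * (4 - 4 * (3 / 4 * (3 / 4 * 1))) * Cmod (z - w)).
      replace (_ - _)%C with (RtoC 0) by ring; rewrite Cmod_0; nra.
    - rewrite sum_Sn.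
      change (Cmod (@sum_n C_AbelianMonoid t (S n) + t (S (S n)) - a 1%nat * (z - w))
         <= 8 * K * d * (4 - 4 * (3 / 4) ^ S (S (S n))) * Cmod (z - w)).
      replace (_ - _)%C
        with ((@sum_n C_AbelianMonoid t (S n) - a 1%nat * (z - w)) + t (S (S n)))%C by ring.
      eapply Rle_trans; [apply Cmod_triangle|].
      specialize (Ht n); simpl pow in *; lra. }
  apply (Cmod_lim_le (@sum_n C_AbelianMonoid t) _ _ _ 1).
  - exact (filterlim_C_Cmod _ _ Hlim).
  - intros [|n] Hn; [lia|].
    eapply Rle_trans; [apply Hsum|].
    apply Rmult_le_compat_r; [apply Cmod_ge_0|].
    assert (0 < (3 / 4) ^ S (S n)) by (apply pow_lt; lra).
    assert (0 < K * d) by (apply Rmult_lt_0_compat; lra); nra.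
Qed.

Lemma analytic_strict_derivative (f : C -> C) (z : C) :
  analytic f -> unit_disk z -> strict_derivative f z (C_derive f z).
Proof.
  intros Hf Hz; destruct (Hf z Hz) as [a [r [Hr Ha]]].
  pose proof (pseries_strict_derivative f z a r Hr Ha) as Hs.
  rewrite (strict_derivative_C_derive f z _ Hs); exact Hs.
Qed.

(** * Transport of univalent disks *)

Lemma disc_le (c : C) (r s : R) (z : C) : r <= s -> disc c r z -> disc c s z.
Proof. unfold disc; lra. Qed.

Lemma disc_unit_disk (x y : C) : disc x (1 - Cmod x) y -> unit_disk y.
Proof.
  unfold disc, unit_disk; intros Hy; pose proof (Cmod_le_add y x); lra.
Qed.

(** A stand-in for local invertibility that fits both [h] and [f]. It supplies local covering for
    the map being inverted and continuity for the other one. *)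
Definition locally_near_scaling (G : C -> C) : Prop :=
  forall x, unit_disk x -> exists lam kap d,
    0 < d /\ 0 <= kap < Cmod lam /\ near_scaling G lam kap (disc x d).

(* On a disk in the image of [p], the map [q o p^-1] is [lam * id] up to a
   [kap]-Lipschitz error, by the mean value inequality along segments. *)
Lemma univalent_disk_transfer (p q : C -> C) (lam kap r s : R) (z : C) :
  locally_near_scaling p -> locally_near_scaling q ->
  0 <= kap < lam ->
  (forall x, unit_disk x -> exists d, 0 < d /\ forall y, disc x d y ->
     Cmod (q y - q x - lam * (p y - p x)) <= kap * Cmod (p y - p x)) ->
  0 < s <= (lam - kap) * r ->
  univalent_disk p z r -> univalent_disk q z s.
Proof.
  intros Hp Hq Hlk Hpq Hs [U [Uopen [Uz [UD [Uinj Uimg]]]]].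
  assert (Hlam : Cmod lam = lam) by (rewrite Cmod_R, Rabs_pos_eq; lra).
  assert (Hr : 0 < r) by nra.
  set (sg := fun w => epsilon (inhabits (RtoC 0)) (fun x => U x /\ p x = w)).
  assert (Hsg : forall w, disc (p z) r w -> U (sg w) /\ p (sg w) = w)
    by (intros w Hw; apply epsilon_spec, Uimg, Hw).
  assert (Himg : forall x, U x -> disc (p z) r (p x))
    by (intros x Ux; apply Uimg; exists x; split; [exact Ux|reflexivity]).
  assert (Hsgp : forall x, U x -> sg (p x) = x).
  { intros x Ux; destruct (Hsg (p x) (Himg x Ux)) as [H1 H2]; apply Uinj; assumption. }
  set (E := fun v => (q (sg v) - lam * v)%C).
  assert (HE : forall v w, disc (p z) r v -> disc (p z) r w ->
            Cmod (E w - E v) <= kap * Cmod (w - v)).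
  { apply disc_lipschitz; intros v Hv.
    destruct (Hsg v Hv) as [Ux Hx]; set (x := sg v) in *.
    destruct (proj1 (locally_C_iff x U) (Uopen x Ux)) as [d1 [Hd1 HdU]].
    destruct (Hp x (UD x Ux)) as [l [k [d2 [Hd2 [Hk Hsc]]]]].
    destruct (Hpq x (UD x Ux)) as [d3 [Hd3 Hcmp]].
    set (d := Rmin d1 (Rmin d2 d3)).
    assert (Hd : 0 < d) by (repeat apply Rmin_pos; assumption).
    assert (Hdle : d <= d1 /\ d <= d2 /\ d <= d3).
    { unfold d; pose proof (Rmin_l d1 (Rmin d2 d3)); pose proof (Rmin_r d1 (Rmin d2 d3)).
      pose proof (Rmin_l d2 d3); pose proof (Rmin_r d2 d3); lra. }
    (* Within this radius of [v], covering by [p] gives [w] a preimage [y] within [d] of [x]. As [y]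
       lies in [U], it is [sg w]: this is the continuity of the inverse branch. *)
    exists ((Cmod l - k) * d); split; [nra|].
    intros w Hw Hwv.
    destruct (near_scaling_covers p l x w k d Hk) as [y [Hy Hyw]].
    - intros a b Ha Hb; apply Hsc; apply (disc_le _ d); tauto.
    - rewrite Hx; exact Hwv.
    - assert (Uy : U y) by (apply HdU, (disc_le _ d); tauto).
      assert (Hy3 : disc x d3 y) by (apply (disc_le _ d); tauto).
      pose proof (Hcmp y Hy3) as Hle.
      rewrite Hx, Hyw in Hle.
      unfold E; rewrite <- Hyw at 1; rewrite (Hsgp y Uy); fold x.
      replace (q y - lam * w - (q x - lam * v))%C
        with (q y - q x - lam * (w - v))%C by ring.
      exact Hle. }
  assert (Hns : near_scaling (fun v => q (sg v)) lam kap (disc (p z) r)).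
  { intros v w Hv Hw; pose proof (HE w v Hw Hv) as Hle; unfold E in Hle.
    replace (q (sg v) - q (sg w) - lam * (v - w))%C
      with (q (sg v) - lam * v - (q (sg w) - lam * w))%C by ring.
    exact Hle. }
  (* [q] may carry [U] beyond the target disk, so [U] is trimmed to the preimage of that disk, which
     is open by continuity of [q]. *)
  exists (fun x => U x /\ disc (q z) s (q x)).
  split; [|split; [|split; [|split]]].
  - intros x [Ux Hx]; apply locally_C_iff.
    destruct (proj1 (locally_C_iff x U) (Uopen x Ux)) as [d1 [Hd1 HdU]].
    destruct (Hq x (UD x Ux)) as [l [k [d2 [Hd2 [Hk Hsc]]]]].
    unfold disc in Hx.
    set (e := (s - Cmod (q x - q z)) / (Cmod l + k)).
    assert (He : 0 < e) by (apply Rdiv_lt_0_compat; lra).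
    exists (Rmin d1 (Rmin d2 e)); split; [repeat apply Rmin_pos; assumption|].
    intros y Hy; unfold disc in Hy.
    assert (Hy' : Cmod (y - x) < d1 /\ Cmod (y - x) < d2 /\ Cmod (y - x) < e).
    { pose proof (Rmin_l d1 (Rmin d2 e)); pose proof (Rmin_r d1 (Rmin d2 e)).
      pose proof (Rmin_l d2 e); pose proof (Rmin_r d2 e); lra. }
    split; [apply HdU; unfold disc; tauto|].
    pose proof (near_scaling_lipschitz q l k _ y x Hsc ltac:(unfold disc; tauto)
                  (disc_center x d2 Hd2)) as HL.
    assert (Hes : (Cmod l + k) * e = s - Cmod (q x - q z)) by (unfold e; field; lra).
    pose proof (Cmod_sub_triangle (q y) (q x) (q z)); unfold disc; nra.
  - split; [exact Uz|apply disc_center, Hs].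
  - intros x [Ux _]; apply UD, Ux.
  - intros x y [Ux _] [Uy _] Hxy; apply Uinj; [exact Ux|exact Uy|].
    pose proof (near_scaling_expands _ _ _ _ _ _ Hns (Himg x Ux) (Himg y Uy)) as Hex.
    cbv beta in Hex; rewrite !Hsgp, Hxy, Cmod_sub_self, Hlam in Hex by assumption.
    apply Cmod_sub_eq_0; nra.
  - intros w; split.
    + intros Hw.
      destruct (near_scaling_covers (fun v => q (sg v)) lam (p z) w kap r) as [v [Hv Hvw]].
      * rewrite Hlam; exact Hlk.
      * exact Hns.
      * cbv beta; rewrite (Hsgp z Uz), Hlam; lra.
      * exists (sg v); split; [|exact Hvw]; split; [apply Hsg, Hv|].
        rewrite Hvw; exact Hw.
    + intros [x [[Ux Hx] <-]]; exact Hx.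
Qed.

Lemma univalent_disk_scale (p q : C -> C) (c z : C) (r : R) :
  c <> 0 -> unit_disk z -> eq_on_disk q (fun x => c * p x)%C ->
  univalent_disk p z r -> univalent_disk q z (Cmod c * r).
Proof.
  intros Hc Hz Hq [U [Uopen [Uz [UD [Uinj Uimg]]]]].
  pose proof (proj1 (Cmod_gt_0 c) Hc) as Hc0.
  exists U; split; [exact Uopen|]; split; [exact Uz|]; split; [exact UD|]; split.
  - intros x y Ux Uy; rewrite (Hq x), (Hq y) by auto; intros Hxy; apply Uinj; auto.
    replace (p x) with (c * p x / c)%C by (field; exact Hc).
    rewrite Hxy; field; exact Hc.
  - intros w.
    assert (Hw : Cmod (w - q z) < Cmod c * r <-> Cmod (w / c - p z) < r).
    { rewrite (Hq z Hz).
      replace (w - c * p z)%C with (c * (w / c - p z))%C by (field; exact Hc).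
      rewrite Cmod_mult; split; [apply Rmult_lt_reg_l, Hc0|apply Rmult_lt_compat_l, Hc0]. }
    rewrite Hw, Uimg; split; intros [x [Ux Hx]]; exists x; split; auto.
    + rewrite (Hq x), Hx by auto; field; exact Hc.
    + rewrite <- Hx, (Hq x) by auto; field; exact Hc.
Qed.

Lemma strict_derivative_near_scaling (h : C -> C) :
  (forall x, unit_disk x -> exists a : C, a <> 0 /\ strict_derivative h x a) ->
  locally_near_scaling h.
Proof.
  intros Hh x Hx; destruct (Hh x Hx) as [a [Ha0 Ha]]; apply Cmod_gt_0 in Ha0.
  destruct (Ha (Cmod a / 2)) as [d [Hd Hns]]; [lra|].
  exists a, (Cmod a / 2), d; split; [|split]; [assumption|lra|assumption].
Qed.

(** * Comparison of [f] with its analytic part *)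

(** The finite-difference form of [|g'| <= k |h'|], local because [h] need not be injective on the
    whole disk. *)
Definition differences_dominated (g h : C -> C) (k : R) : Prop :=
  forall x, unit_disk x -> exists d, 0 < d /\ forall y w, disc x d y -> disc x d w ->
    Cmod (g y - g w) <= k * Cmod (h y - h w).

Lemma strict_derivative_dominated (g h : C -> C) (k l : R) :
  0 <= k < l -> l <= 1 ->
  (forall x, unit_disk x -> exists a b : C, a <> 0 /\ Cmod b <= k * Cmod a /\
     strict_derivative h x a /\ strict_derivative g x b) ->
  differences_dominated g h l.
Proof.
  intros Hkl Hl Hgh x Hx; destruct (Hgh x Hx) as [a [b [Ha0 [Hab [Ha Hb]]]]].
  apply Cmod_gt_0 in Ha0.
  (* The errors in both derivatives are absorbed if [(1 + l) * e <= (l - k) * Cmod a], and [l <= 1]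
     allows half of the gap. *)
  set (e := (l - k) * Cmod a / 2).
  assert (He : 0 < e) by (unfold e; nra).
  destruct (Ha e He) as [d1 [Hd1 H1]]; destruct (Hb e He) as [d2 [Hd2 H2]].
  exists (Rmin d1 d2); split; [apply Rmin_pos; assumption|].
  intros y w Hy Hw.
  pose proof (disc_le _ _ _ _ (Rmin_l d1 d2) Hy) as Hy1.
  pose proof (disc_le _ _ _ _ (Rmin_l d1 d2) Hw) as Hw1.
  pose proof (disc_le _ _ _ _ (Rmin_r d1 d2) Hy) as Hy2.
  pose proof (disc_le _ _ _ _ (Rmin_r d1 d2) Hw) as Hw2.
  pose proof (near_scaling_expands _ _ _ _ _ _ H1 Hy1 Hw1) as H3.
  pose proof (near_scaling_lipschitz _ _ _ _ _ _ H2 Hy2 Hw2) as H4.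
  assert (Cmod b + e <= l * (Cmod a - e)) by (unfold e in *; nra).
  pose proof (Cmod_ge_0 (y - w)); nra.
Qed.

(** The antianalytic part has no complex derivative and is counted wholly as error. Being dominated
    by [h] with [k < 1], it leaves the scaling by [h'(x)] dominant. *)
Lemma harmonic_near_scaling (f h g : C -> C) (k : R) :
  0 <= k < 1 ->
  (forall x, unit_disk x -> exists a : C, a <> 0 /\ strict_derivative h x a) ->
  differences_dominated g h k ->
  eq_on_disk f (fun z => h z + Cconj (g z))%C ->
  locally_near_scaling f.
Proof.
  intros Hk Hh Hgh Hf x Hx.
  destruct (Hh x Hx) as [a [Ha0 Ha]]; apply Cmod_gt_0 in Ha0.
  destruct (Hgh x Hx) as [d1 [Hd1 H1]].
  (* The total error is [k * Cmod a + (1 + k) * e], and [(1 + k) * e < 2 * e = (1 - k) * Cmod a /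
     2], so it stays below [Cmod a]. *)
  set (e := (1 - k) * Cmod a / 4).
  assert (He : 0 < e) by (unfold e; nra).
  destruct (Ha e He) as [d2 [Hd2 H2]].
  set (d := Rmin (1 - Cmod x) (Rmin d1 d2)).
  assert (Hdle : d <= 1 - Cmod x /\ d <= d1 /\ d <= d2).
  { unfold d; pose proof (Rmin_l (1 - Cmod x) (Rmin d1 d2));
      pose proof (Rmin_r (1 - Cmod x) (Rmin d1 d2)).
    pose proof (Rmin_l d1 d2); pose proof (Rmin_r d1 d2); lra. }
  exists a, (k * (Cmod a + e) + e), d.
  split; [unfold unit_disk in Hx; repeat apply Rmin_pos; lra|].
  split; [unfold e in *; nra|].
  intros y w Hy Hw.
  rewrite (Hf y), (Hf w)
    by (apply (disc_unit_disk x), (disc_le _ d); tauto).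
  assert (Hg : Cmod (Cconj (g y - g w)) <= k * Cmod (h y - h w))
    by (rewrite Cmod_conj; apply H1; apply (disc_le _ d); tauto).
  assert (Hy2 : disc x d2 y) by (apply (disc_le _ d); tauto).
  assert (Hw2 : disc x d2 w) by (apply (disc_le _ d); tauto).
  pose proof (H2 y w Hy2 Hw2) as H3.
  pose proof (near_scaling_lipschitz _ _ _ _ _ _ H2 Hy2 Hw2) as H4.
  rewrite Cminus_conj in Hg.
  replace (h y + Cconj (g y) - (h w + Cconj (g w)) - a * (y - w))%C
    with ((h y - h w - a * (y - w)) + (Cconj (g y) - Cconj (g w)))%C by ring.
  eapply Rle_trans; [apply Cmod_triangle|]; nra.
Qed.

Lemma univalent_disk_harmonic_of_analytic (f h g : C -> C) (k r s : R) (z : C) :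
  0 <= k < 1 ->
  locally_near_scaling h -> locally_near_scaling f ->
  differences_dominated g h k ->
  eq_on_disk f (fun z => h z + Cconj (g z))%C ->
  0 < s <= (1 - k) * r ->
  univalent_disk h z r -> univalent_disk f z s.
Proof.
  intros Hk Hh Hf Hgh Hfe Hs.
  apply (univalent_disk_transfer h f 1 k); auto.
  intros x Hx; destruct (Hgh x Hx) as [d [Hd Hle]].
  exists (Rmin (1 - Cmod x) d); split; [unfold unit_disk in Hx; apply Rmin_pos; lra|].
  intros y Hy.
  pose proof (disc_le _ _ _ _ (Rmin_r (1 - Cmod x) d) Hy) as Hyd.
  apply disc_le with (s := 1 - Cmod x) in Hy; [|apply Rmin_l].
  apply disc_unit_disk in Hy.
  rewrite (Hfe y Hy), (Hfe x Hx).
  replace (_ - _ - 1 * (h y - h x))%C with (Cconj (g y) - Cconj (g x))%C by ring.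
  rewrite <- Cminus_conj, Cmod_conj; apply Hle; [exact Hyd|apply disc_center, Hd].
Qed.

(* After clearing denominators and squaring, this is
   [(1 - k^2) (|Y|^2 - k^2 |X|^2) <= 0]. *)
Lemma Cmod_inverse_distortion (X Y : C) (k : R) :
  0 <= k < 1 -> Cmod Y <= k * Cmod X ->
  Cmod (X - (/ (1 - k ^ 2))%R * (X + Cconj Y))
    <= k * / (1 - k ^ 2) * Cmod (X + Cconj Y).
Proof.
  intros Hk HXY.
  assert (Hk2 : 0 < 1 - k ^ 2) by nra.
  assert (Hl : 0 < / (1 - k ^ 2)) by (apply Rinv_0_lt_compat, Hk2).
  assert (Hsq : Cmod Y ^ 2 <= k ^ 2 * Cmod X ^ 2).
  { rewrite <- Rpow_mult_distr; apply pow_incr; split; [apply Cmod_ge_0|exact HXY]. }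
  replace (X - (/ (1 - k ^ 2))%R * (X + Cconj Y))%C
    with (- ((/ (1 - k ^ 2))%R * ((k ^ 2)%R * X + Cconj Y)))%C.
  - rewrite Cmod_opp, Cmod_mult, Cmod_R, Rabs_pos_eq by lra.
    rewrite (Rmult_comm k), Rmult_assoc; apply Rmult_le_compat_l; [lra|].
    apply Rsqr_incr_0_var; [|apply Rmult_le_pos; [lra|apply Cmod_ge_0]].
    rewrite !Rsqr_pow2, Rpow_mult_distr, !Cmod2_alt.
    rewrite !Cmod2_alt in Hsq.
    destruct X as [x1 x2]; destruct Y as [y1 y2]; simpl in *; nra.
  - rewrite RtoC_inv, RtoC_minus; [|lra].
    assert ((1 - RtoC (k ^ 2))%C <> 0).
    { rewrite <- RtoC_minus; intros H0; apply RtoC_inj in H0; lra. }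
    field; assumption.
Qed.

(** Centring at [1 / (1 - k^2)] gives the covering factor [(1 - k) / (1 - k^2) = 1 / (1 + k)]. With
    [lam = 1] the error would be [k / (1 - k)], and the factor [(1 - 2 * k) / (1 - k)] is not
    positive once [k >= 1 / 2]. *)
Lemma univalent_disk_analytic_of_harmonic (f h g : C -> C) (k r s : R) (z : C) :
  0 <= k < 1 ->
  locally_near_scaling h -> locally_near_scaling f ->
  differences_dominated g h k ->
  eq_on_disk f (fun z => h z + Cconj (g z))%C ->
  0 < s <= r / (1 + k) ->
  univalent_disk f z r -> univalent_disk h z s.
Proof.
  intros Hk Hh Hf Hgh Hfe Hs.
  assert (Hl : 0 < / (1 - k ^ 2)) by (apply Rinv_0_lt_compat; nra).
  apply (univalent_disk_transfer f h (/ (1 - k ^ 2)) (k * / (1 - k ^ 2))); auto.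
  - nra.
  - intros x Hx; destruct (Hgh x Hx) as [d [Hd Hle]].
    exists (Rmin (1 - Cmod x) d); split; [unfold unit_disk in Hx; apply Rmin_pos; lra|].
    intros y Hy.
    pose proof (disc_le _ _ _ _ (Rmin_r (1 - Cmod x) d) Hy) as Hyd.
    apply disc_le with (s := 1 - Cmod x) in Hy; [|apply Rmin_l].
    apply disc_unit_disk in Hy.
    rewrite (Hfe y Hy), (Hfe x Hx).
    replace (h y + Cconj (g y) - (h x + Cconj (g x)))%C
      with ((h y - h x) + Cconj (g y - g x))%C by (rewrite Cminus_conj; ring).
    apply Cmod_inverse_distortion; [exact Hk|].
    apply Hle; [exact Hyd|apply disc_center, Hd].
  - replace ((/ (1 - k ^ 2) - k * / (1 - k ^ 2)) * r) with (r / (1 + k))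
      by (field; split; nra); exact Hs.
Qed.

(** [harmonic_class] speaks of some decomposition of [f], while the theorem fixes another. Equality
    of the derivatives is enough to pass the dilatation bound and the normalization from one to the
    other. *)
Lemma harmonic_derivatives_unique (h g h1 g1 : C -> C) (z a b a1 b1 : C) :
  unit_disk z ->
  eq_on_disk (fun z => h z + Cconj (g z))%C (fun z => h1 z + Cconj (g1 z))%C ->
  strict_derivative h z a -> strict_derivative g z b ->
  strict_derivative h1 z a1 -> strict_derivative g1 z b1 ->
  a = a1 /\ b = b1.
Proof.
  intros Hz Heq Ha Hb Ha1 Hb1.
  (* Along a step [u] in direction [c] both sums have the same increment, so only the four
     derivative errors remain, each at most [eps / 4] times the step length. *)
  assert (HL : forall c, Cmod c = 1 -> Cmod ((a - a1) * c + Cconj ((b - b1) * c)) <= 0).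
  { intros c Hc; apply le_epsilon; intros eps Heps.
    destruct (Ha (eps / 4) ltac:(lra)) as [d1 [Hd1 H1]].
    destruct (Hb (eps / 4) ltac:(lra)) as [d2 [Hd2 H2]].
    destruct (Ha1 (eps / 4) ltac:(lra)) as [d3 [Hd3 H3]].
    destruct (Hb1 (eps / 4) ltac:(lra)) as [d4 [Hd4 H4]].
    set (d := Rmin (Rmin d1 d2) (Rmin (Rmin d3 d4) (1 - Cmod z))).
    assert (Hd : 0 < d) by (unfold unit_disk in Hz; repeat apply Rmin_pos; lra).
    assert (Hdle : d <= d1 /\ d <= d2 /\ d <= d3 /\ d <= d4 /\ d <= 1 - Cmod z).
    { unfold d.
      pose proof (Rmin_l (Rmin d1 d2) (Rmin (Rmin d3 d4) (1 - Cmod z))).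
      pose proof (Rmin_r (Rmin d1 d2) (Rmin (Rmin d3 d4) (1 - Cmod z))).
      pose proof (Rmin_l (Rmin d3 d4) (1 - Cmod z)).
      pose proof (Rmin_r (Rmin d3 d4) (1 - Cmod z)).
      pose proof (Rmin_l d1 d2); pose proof (Rmin_r d1 d2).
      pose proof (Rmin_l d3 d4); pose proof (Rmin_r d3 d4); lra. }
    set (u := ((d / 2)%R * c)%C).
    assert (Hu : Cmod u = d / 2)
      by (unfold u; rewrite Cmod_mult, Cmod_R, Rabs_pos_eq, Hc; lra).
    assert (Hzu : disc z d (z + u)%C).
    { unfold disc; replace (z + u - z)%C with u by ring; lra. }
    pose proof (disc_center z d Hd) as Hzz.
    assert (Hin : forall e, d <= e -> disc z e (z + u)%C /\ disc z e z)
      by (intros e He; split; apply (disc_le z d); assumption).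
    assert (K1 := H1 _ _ (proj1 (Hin d1 ltac:(tauto))) (proj2 (Hin d1 ltac:(tauto)))).
    assert (K2 := H2 _ _ (proj1 (Hin d2 ltac:(tauto))) (proj2 (Hin d2 ltac:(tauto)))).
    assert (K3 := H3 _ _ (proj1 (Hin d3 ltac:(tauto))) (proj2 (Hin d3 ltac:(tauto)))).
    assert (K4 := H4 _ _ (proj1 (Hin d4 ltac:(tauto))) (proj2 (Hin d4 ltac:(tauto)))).
    replace (z + u - z)%C with u in K1, K2, K3, K4 by ring.
    rewrite Hu in K1, K2, K3, K4.
    pose proof (Heq z Hz) as E0.
    assert (E1 := Heq (z + u)%C (disc_unit_disk z _ (proj1 (Hin (1 - Cmod z) ltac:(tauto))))).
    cbv beta in E0, E1.
    rewrite <- Cmod_conj in K2, K4.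
    set (X1 := (h (z + u) - h z - a * u)%C) in *.
    set (X2 := Cconj (g (z + u) - g z - b * u)%C) in *.
    set (X3 := (h1 (z + u) - h1 z - a1 * u)%C) in *.
    set (X4 := Cconj (g1 (z + u) - g1 z - b1 * u)%C) in *.
    assert (Hid : ((a - a1) * u + Cconj ((b - b1) * u))%C = (X3 + X4 + - (X1 + X2))%C).
    { unfold X1, X2, X3, X4; rewrite !Cminus_conj, !Cmult_conj, !Cminus_conj.
      replace (h (z + u))%C with (h1 (z + u) + Cconj (g1 (z + u)) - Cconj (g (z + u)))%C
        by (rewrite <- E1; ring).
      replace (h z)%C with (h1 z + Cconj (g1 z) - Cconj (g z))%C
        by (rewrite <- E0; ring).
      ring. }
    assert (Hle : Cmod ((a - a1) * u + Cconj ((b - b1) * u)) <= eps * (d / 2)).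
    { rewrite Hid.
      eapply Rle_trans; [apply Cmod_triangle|]; rewrite Cmod_opp.
      pose proof (Cmod_triangle X1 X2); pose proof (Cmod_triangle X3 X4); lra. }
    replace ((a - a1) * u + Cconj ((b - b1) * u))%C
      with ((d / 2)%R * ((a - a1) * c + Cconj ((b - b1) * c)))%C in Hle.
    - rewrite Cmod_mult, Cmod_R, Rabs_pos_eq in Hle by lra.
      apply Rmult_le_reg_l with (d / 2); lra.
    - unfold u; rewrite !Cmult_conj.
      replace (Cconj (d / 2)%R) with (RtoC (d / 2))
        by (unfold Cconj, RtoC; simpl; f_equal; ring).
      ring. }
  (* With [A = a - a1] and [B = b - b1], direction 1 gives [A + conj B = 0] and direction [i] gives
     [A - conj B = 0]. *)
  pose proof (HL 1%C Cmod_1) as L1; pose proof (HL Ci Cmod_Ci) as L2.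
  assert (Hz0 : forall x, Cmod x <= 0 -> x = 0)
    by (intros x Hx; apply Cmod_eq_0; pose proof (Cmod_ge_0 x); lra).
  apply Hz0 in L1; apply Hz0 in L2.
  destruct a, b, a1, b1.
  unfold Cconj, Cplus, Cmult, Cminus, Copp, Ci, RtoC in L1, L2; simpl in L1, L2.
  injection L1 as L11 L12; injection L2 as L21 L22.
  split; f_equal; lra.
Qed.

(** * Suprema of radii and the conclusion *)

Lemma Rbar_div_le_of_le_mult (x y : Rbar) (Q : R) :
  0 < Q -> Rbar_le x (Rbar_mult Q y) -> Rbar_le (Rbar_div x Q) y.
Proof.
  intros HQ.
  assert (HQ' : 0 < / Q) by (apply Rinv_0_lt_compat, HQ).
  destruct x as [x| |], y as [y| |]; unfold Rbar_div, Rbar_mult; simpl;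
    repeat (destruct Rle_dec as [?|?]; try lra; simpl);
    repeat (destruct Rle_lt_or_eq_dec as [?|?]; try lra; simpl); auto.
  intros Hx; apply Rmult_le_reg_l with Q; [exact HQ|].
  replace (Q * (x * / Q)) with x by (field; lra); exact Hx.
Qed.

(** Losing any factor [Q' > Q] on individual radii costs only [Q] on the supremum, as [Q'] decreases
    to [Q]. *)
Lemma Lub_Rbar_le_mult (A B : R -> Prop) (Q : R) :
  0 < Q -> (forall Q' r, Q < Q' -> A r -> B (r / Q')) ->
  Rbar_le (Lub_Rbar A) (Rbar_mult Q (Lub_Rbar B)).
Proof.
  intros HQ HAB; apply Lub_Rbar_correct; intros r Ar.
  assert (HB : forall Q', Q < Q' -> Rbar_le (r / Q') (Lub_Rbar B))
    by (intros Q' HQ'; apply Lub_Rbar_correct, HAB; assumption).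
  destruct (Lub_Rbar B) as [l| |].
  - simpl in *.
    assert (Hr : forall Q', Q < Q' -> r <= Q' * l).
    { intros Q' HQ'; replace r with (Q' * (r / Q')) by (field; lra).
      apply Rmult_le_compat_l; [lra|auto]. }
    (* For [l <= 0] any [Q'] suffices, since [Q' * l <= Q * l]; for [l > 0] the choice [Q + eps / l]
       costs exactly [eps]. *)
    destruct (Rle_lt_dec l 0) as [Hl|Hl].
    + specialize (Hr (Q + 1) ltac:(lra)); lra.
    + apply le_epsilon; intros eps Heps.
      assert (0 < eps / l) by (apply Rdiv_lt_0_compat; assumption).
      specialize (Hr (Q + eps / l) ltac:(lra)).
      replace (Q * l + eps) with ((Q + eps / l) * l) by (field; lra); exact Hr.
  - unfold Rbar_mult; simpl.
    destruct Rle_dec; [|lra]; destruct Rle_lt_or_eq_dec; [exact I|lra].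
  - destruct (HB (Q + 1)); lra.
Qed.

Theorem corollary1 :
  forall (alpha : Rbar) (Q : R) (f h g H : C -> C),
    Rbar_le 1 alpha ->
    1 <= Q ->
    harmonic_class alpha Q f ->
    harmonic_decomposition f h g ->
    eq_on_disk h (fun z => C_derive h 0 * H z)%C ->
    forall z : C, unit_disk z ->
      Rbar_le (Rbar_div (univalent_radius H z) Q) (univalent_radius f z) /\
      Rbar_le (univalent_radius f z) (Rbar_mult Q (univalent_radius H z)).
Proof.
  intros alpha Q f h g H _ HQ
    [h1 [g1 [[Ah1 [Ag1 [_ [_ Ef1]]]] [Hjac [Hnorm [_ Hdil]]]]]]
    [Ah [Ag [_ [_ Ef]]]] EH z Hz.
  assert (Hder : forall x, unit_disk x ->
            C_derive h x = C_derive h1 x /\ C_derive g x = C_derive g1 x).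
  { intros x Hx.
    apply (harmonic_derivatives_unique h g h1 g1 x); auto using analytic_strict_derivative.
    intros y Hy; rewrite <- (Ef y Hy); apply Ef1, Hy. }
  set (k := (Q - 1) / (Q + 1)) in *.
  assert (Hk : 0 <= k).
  { apply Rmult_le_pos; [lra|]; apply Rlt_le, Rinv_0_lt_compat; lra. }
  assert (Hgh : forall x, unit_disk x -> exists a b : C, a <> 0 /\ Cmod b <= k * Cmod a /\
            strict_derivative h x a /\ strict_derivative g x b).
  { intros x Hx; exists (C_derive h x), (C_derive g x).
    destruct (Hder x Hx) as [Eh Eg].
    assert (Ha0 : C_derive h x <> 0).
    { rewrite Eh; intros H0; specialize (Hjac x Hx).
      rewrite H0, Cmod_0 in Hjac; pose proof (Cmod_ge_0 (C_derive g1 x)); nra. }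
    split; [exact Ha0|]; split; [|split; apply analytic_strict_derivative; assumption].
    specialize (Hdil x Hx); rewrite <- Eh, <- Eg, Cmod_div in Hdil by exact Ha0.
    apply Cmod_gt_0 in Ha0.
    replace (Cmod (C_derive g x))
      with (Cmod (C_derive g x) / Cmod (C_derive h x) * Cmod (C_derive h x)) by (field; lra).
    apply Rmult_le_compat_r; [lra|exact Hdil]. }
  assert (H00 : unit_disk 0) by (unfold unit_disk; rewrite Cmod_0; lra).
  set (a0 := C_derive h 0) in *; set (b0 := C_derive g 0).
  assert (Ha0 : a0 <> 0 /\ Cmod b0 <= k * Cmod a0).
  { destruct (Hgh 0 H00) as [a [b [Ha [Hab [Sa Sb]]]]].
    unfold a0, b0; rewrite (strict_derivative_C_derive _ _ _ Sa),
      (strict_derivative_C_derive _ _ _ Sb); tauto. }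
  destruct Ha0 as [Ha0 Hb0].
  assert (Hn : Cmod (a0 + Cconj b0) = 1).
  { destruct (Hder 0 H00) as [Eh Eg]; unfold a0, b0.
    rewrite Eh, Eg, Hnorm; apply Cmod_1. }
  assert (Hlow : 1 <= (1 + k) * Cmod a0).
  { pose proof (Cmod_triangle a0 (Cconj b0)) as Ht; rewrite Cmod_conj in Ht; lra. }
  assert (Hup : (1 - k) * Cmod a0 <= 1).
  { pose proof (Cmod_add_le a0 (Cconj b0)) as Ht; rewrite Cmod_conj in Ht; lra. }
  pose proof (proj1 (Cmod_gt_0 a0) Ha0) as Ha0'.
  assert (Hh : forall x, unit_disk x -> exists a : C, a <> 0 /\ strict_derivative h x a).
  { intros x Hx; destruct (Hgh x Hx) as [a [b [Ha [_ [Sa _]]]]]; exists a; tauto. }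
  assert (EH' : eq_on_disk H (fun x => / a0 * h x)%C).
  { intros x Hx; rewrite (EH x Hx); field; exact Ha0. }
  pose proof (strict_derivative_near_scaling h Hh) as Lh.
  (* Differences are only dominated with constants [l > k], hence [Q' > Q]. *)
  assert (Hl : forall Q', Q < Q' -> exists l, k < l < 1 /\
            1 / Q' = (1 - l) / (1 + l) /\ differences_dominated g h l /\
            locally_near_scaling f).
  (* The map from [Q] to [k] is increasing, so [Q' > Q] provides the margin [l > k]. *)
  { intros Q' HQ'; exists ((Q' - 1) / (Q' + 1)).
    assert (Hkl : k < (Q' - 1) / (Q' + 1)).
    { unfold k; apply Rmult_lt_reg_r with ((Q + 1) * (Q' + 1)); [nra|].
      replace ((Q - 1) / (Q + 1) * ((Q + 1) * (Q' + 1)))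
        with ((Q - 1) * (Q' + 1)) by (field; lra).
      replace ((Q' - 1) / (Q' + 1) * ((Q + 1) * (Q' + 1)))
        with ((Q' - 1) * (Q + 1)) by (field; lra); nra. }
    assert (Hl1 : (Q' - 1) / (Q' + 1) < 1).
    { apply Rmult_lt_reg_r with (Q' + 1); [lra|].
      replace ((Q' - 1) / (Q' + 1) * (Q' + 1)) with (Q' - 1) by (field; lra); lra. }
    assert (Hdom : differences_dominated g h ((Q' - 1) / (Q' + 1))).
    { apply (strict_derivative_dominated g h k); [lra|lra|exact Hgh]. }
    split; [lra|]; split; [field; lra|]; split; [exact Hdom|].
    apply (harmonic_near_scaling f h g ((Q' - 1) / (Q' + 1))); auto; lra. }
  split.
  - apply Rbar_div_le_of_le_mult; [lra|].
    apply Lub_Rbar_le_mult; [lra|].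
    intros Q' r HQ' [Hr Hu].
    assert (HrQ : 0 < r / Q') by (apply Rdiv_lt_0_compat; lra).
    split; [exact HrQ|].
    destruct (Hl Q' HQ') as [l [Hkl [EQ [Hdom Lf]]]].
    apply (univalent_disk_harmonic_of_analytic f h g l (Cmod a0 * r)); auto; [lra| |].
    + split; [exact HrQ|].
      (* Once denominators are cleared this is [1 <= (1 + l) * Cmod a0], which follows from [Hlow]
         and [k < l]. *)
      replace (r / Q') with (1 / Q' * r) by (field; lra); rewrite EQ.
      apply Rmult_le_reg_r with (1 + l); [lra|].
      replace ((1 - l) / (1 + l) * r * (1 + l)) with ((1 - l) * r * 1) by (field; lra).
      replace ((1 - l) * (Cmod a0 * r) * (1 + l))
        with ((1 - l) * r * ((1 + l) * Cmod a0)) by ring.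
      apply Rmult_le_compat_l; [apply Rmult_le_pos|]; nra.
    + apply (univalent_disk_scale H h); assumption.
  - apply Lub_Rbar_le_mult; [lra|].
    intros Q' r HQ' [Hr Hu].
    assert (HrQ : 0 < r / Q') by (apply Rdiv_lt_0_compat; lra).
    split; [exact HrQ|].
    destruct (Hl Q' HQ') as [l [Hkl [EQ [Hdom Lf]]]].
    replace (r / Q') with (Cmod (/ a0) * (Cmod a0 * (r / Q')))
      by (rewrite Cmod_inv by exact Ha0; field; lra).
    assert (Hia0 : (/ a0)%C <> 0).
    { apply Cmod_gt_0; rewrite Cmod_inv by exact Ha0; apply Rinv_0_lt_compat, Ha0'. }
    apply (univalent_disk_scale h H); [exact Hia0|exact Hz|exact EH'|].
    apply (univalent_disk_analytic_of_harmonic f h g l r); auto; [lra|].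
    split; [nra|].
    (* Here the claim reduces to [(1 - l) * Cmod a0 <= 1], which follows from [Hup] and [k < l]. *)
    replace (r / Q') with (1 / Q' * r) by (field; lra); rewrite EQ.
    apply Rmult_le_reg_r with (1 + l); [lra|].
    replace (Cmod a0 * ((1 - l) / (1 + l) * r) * (1 + l))
      with ((1 - l) * Cmod a0 * r) by (field; lra).
    replace (r / (1 + l) * (1 + l)) with (1 * r) by (field; lra).
    apply Rmult_le_compat_r; nra.
Qed.
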